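(* Let $\varphi$ be a strictly decreasing symbol for $\mathcal{S}(\mathbb{R})$, and let $C_\varphi:\mathcal{S}(\mathbb{R})\to\mathcal{S}(\mathbb{R})$, $f\mapsto f\circ\varphi$. Then the following are equivalent: (a) $\sigma_p(C_\varphi)\neq\emptyset$. (b) The set $\{t\in\mathbb{R}:\varphi(\varphi(t))=t\}$ has interior points. (c) $\sigma_p(C_\varphi)=\{-1,1\}$.
   Context: $\mathcal{S}(\mathbb{R})$ is the Schwartz space of smooth rapidly decreasing functions $f:\mathbb{R}\to\mathbb{C}$ with its usual Fréchet topology, given by the seminorms $\pi_n(f)=\sup_{x\in\mathbb{R}}\sup_{0\le j\le n}(1+|x|^2)^n|f^{(j)}(x)|$, $n\in\mathbb{N}$. A smooth function $\varphi:\mathbb{R}\to\mathbb{R}$ is a symbol for $\mathcal{S}(\mathbb{R})$ if $f\mapsto f\circ\varphi$ maps $\mathcal{S}(\mathbb{R})$ continuously into itself. $\sigma_p(C_\varphi)$ is the set of all eigenvalues $\lambda\in\mathbb{C}$ of $C_\varphi$. *)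

(* Defs.v *)
From Stdlib Require Import Reals Lra Lia.
From Coquelicot Require Import Coquelicot.
Open Scope R_scope.

(* The derivative of a complex-valued function of a real variable is taken on
   the real and imaginary parts separately.  [Derive_n] is a total function,
   only meaningful together with the differentiability predicates below. *)
Definition CDerive_n (f : R -> C) (j : nat) (x : R) : C :=
  (Derive_n (fun t => Re (f t)) j x, Derive_n (fun t => Im (f t)) j x).

Definition smooth (f : R -> R) : Prop := forall n x, ex_derive_n f n x.

Definition Csmooth (f : R -> C) : Prop :=
  smooth (fun t => Re (f t)) /\ smooth (fun t => Im (f t)).

Definition schwartz_seminorm (n : nat) (f : R -> C) : Rbar :=
  Lub_Rbar (fun y => exists (x : R) (j : nat), (j <= n)%nat /\
    y = (1 + Rabs x ^ 2) ^ n * Cmod (CDerive_n f j x)).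

Record schwartz : Type := Schwartz {
  schwartz_fun :> R -> C;
  schwartz_smooth : Csmooth schwartz_fun;
  schwartz_decay : forall n, is_finite (schwartz_seminorm n schwartz_fun)
}.

(* Neighbourhood filter of f in the locally convex topology defined by the
   seminorms: basic neighbourhoods are balls for finitely many of them. *)
Definition schwartz_nbhs (f : schwartz) (P : schwartz -> Prop) : Prop :=
  exists (n : nat) (eps : posreal), forall g : schwartz,
    (forall k, (k <= n)%nat ->
       Rbar_lt (schwartz_seminorm k (fun x => Cminus (g x) (f x))) eps) ->
    P g.

Global Instance schwartz_nbhs_filter (f : schwartz) : Filter (schwartz_nbhs f).
Proof.
split.
- exists 0%nat, (mkposreal 1 Rlt_0_1); auto.
- intros P Q (n & e & HP) (m & d & HQ).
  exists (Nat.max n m), (mkposreal _ (Rmin_stable_in_posreal e d)).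
  intros g Hg; split.
  + apply HP; intros k Hk; eapply Rbar_lt_le_trans; [apply Hg; lia|].
    apply Rmin_l.
  + apply HQ; intros k Hk; eapply Rbar_lt_le_trans; [apply Hg; lia|].
    apply Rmin_r.
- intros P Q HPQ (n & e & HP); exists n, e; auto.
Qed.

Definition schwartz_continuous (T : schwartz -> schwartz) : Prop :=
  forall f, filterlim T (schwartz_nbhs f) (schwartz_nbhs (T f)).

(* [comp_op] is determined by [comp_opE] up to extensionality; its existence says
   that the Schwartz space is stable under f |-> f o phi. *)
Record symbol : Type := Symbol {
  symbol_fun :> R -> R;
  symbol_smooth : smooth symbol_fun;
  comp_op : schwartz -> schwartz;
  comp_opE : forall (f : schwartz) (x : R), comp_op f x = f (symbol_fun x);
  comp_op_continuous : schwartz_continuous comp_op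
}.

(* Set of eigenvalues of T; equality in the Schwartz space is written pointwise. *)
Definition point_spectrum (T : schwartz -> schwartz) (lambda : C) : Prop :=
  exists f : schwartz,
    (exists x : R, f x <> RtoC 0) /\
    forall x : R, T f x = Cmult lambda (f x).

(* Main.v *)
Require Import Defs.
From Stdlib Require Import Reals Lra Lia Classical.
From Coquelicot Require Import Coquelicot.
Open Scope R_scope.

(** Write psi for phi o phi, a strictly increasing continuous map.

    An eigenfunction f with eigenvalue lambda gives bounded values
    lambda^n f(x) along the orbit of x. Composing phi with a bump function shows
    that |phi| tends to infinity ([symbol_proper]), so phi is onto
    ([symbol_surjective]) and orbits can be followed backwards as well; hence
    |lambda| = 1 ([bounded_scaling_factor]) and |f|^2 is invariant under psi.

    The psi-orbits are monotone, so each tends to a fixed point of psi or to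
    infinity, where f vanishes. All the points between x and psi(x) have orbits
    with the same end, so |f|^2 is constant on that segment, equal to its value
    at a fixed point of psi or to 0 ([invariant_on_segment]). This has two
    consequences.
    - If the fixed points of psi have empty interior, the derivative of |f|^2
      vanishes at points arbitrarily close to any given point, so it vanishes
      identically by continuity, and f = 0
      ([invariant_zero_of_sparse_fixpoints]).
    - At a fixed point f = lambda^2 f. If lambda^2 <> 1, then f is zero at the
      fixed points, hence everywhere; so lambda = 1 or lambda = -1.

    Conversely, a bump u on a small interval of fixed points of psi satisfies
    u o psi = u, and u + c (u o phi) is an eigenfunction for c = 1 and c = -1
    ([pm1_eigenvalue]). The existence of bump functions is derived from the
    smoothness of e^(-1/x) extended by 0. *)

(** * Smooth bump functions *)

(** The exponent k makes the derivative of a flat function a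
    combination of flat functions, since (x^-k e^(-1/x))' is
    x^-(k+2) e^(-1/x) - k x^-(k+1) e^(-1/x). *)
Definition flat (k : nat) (x : R) : R :=
  if Rle_dec x 0 then 0 else (/ x) ^ k * exp (- / x).

Lemma flat_nonpos k x : x <= 0 -> flat k x = 0.
Proof. intros H; unfold flat; destruct Rle_dec; lra. Qed.

Lemma flat_pos k x : 0 < x -> 0 < flat k x.
Proof.
  intros H; unfold flat; destruct Rle_dec; [lra|].
  apply Rmult_lt_0_compat; [apply pow_lt, Rinv_0_lt_compat, H | apply exp_pos].
Qed.

Lemma pow_div_fact_le_exp n y : 0 <= y -> y ^ n / INR (Factorial.fact n) <= exp y.
Proof.
  intros Hy; eapply Rle_trans; [|apply (exp_ge_taylor y n Hy)].
  assert (Hk : forall k, 0 <= y ^ k / INR (Factorial.fact k)).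
  { intros k; apply Rmult_le_pos; [apply pow_le, Hy|].
    apply Rlt_le, Rinv_0_lt_compat, INR_fact_lt_0. }
  destruct n as [|n]; [right; reflexivity|]; rewrite tech5.
  generalize (cond_pos_sum _ n Hk); lra.
Qed.

(** Quadratic vanishing at the origin is all that differentiability there
    requires; it holds because exp grows faster than any power. *)
Lemma flat_le_sqr k : exists M, 0 < M /\ forall x, Rabs (flat k x) <= M * x ^ 2.
Proof.
  set (n := (k + 2)%nat).
  assert (HN : 0 < INR (Factorial.fact n)) by apply INR_fact_lt_0.
  exists (INR (Factorial.fact n)); split; [exact HN|].
  intros x; destruct (Rle_lt_dec x 0) as [H|H].
  - rewrite flat_nonpos, Rabs_R0 by exact H.
    apply Rmult_le_pos; [lra | apply pow2_ge_0].
  - rewrite Rabs_pos_eq by (apply Rlt_le, flat_pos, H).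
    unfold flat; destruct Rle_dec; [lra|].
    assert (Hy : 0 < / x) by (apply Rinv_0_lt_compat, H).
    assert (He := pow_div_fact_le_exp n (/ x) (Rlt_le _ _ Hy)).
    rewrite exp_Ropp.
    apply Rmult_le_reg_r with (exp (/ x)); [apply exp_pos|].
    rewrite Rmult_assoc, Rinv_l, Rmult_1_r
      by (apply Rgt_not_eq, exp_pos).
    apply Rle_trans with (INR (Factorial.fact n) * x ^ 2 * ((/ x) ^ n / INR (Factorial.fact n))).
    + right; unfold n at 2; rewrite pow_add; field; lra.
    + apply Rmult_le_compat_l; [|exact He].
      apply Rmult_le_pos; [lra | apply pow2_ge_0].
Qed.

Lemma is_derive_0_of_le_sqr f M : 0 < M ->
  (forall x, Rabs (f x) <= M * x ^ 2) -> is_derive f 0 0.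
Proof.
  intros HM H.
  assert (H0 : f 0 = 0).
  { specialize (H 0). apply Rabs_eq_0, Rle_antisym; [lra | apply Rabs_pos]. }
  apply is_derive_Reals; intros eps Heps.
  assert (Hd : 0 < eps / M) by (apply Rdiv_lt_0_compat; lra).
  exists (mkposreal _ Hd); simpl; intros h Hh Hhd.
  rewrite Rplus_0_l, H0, !Rminus_0_r.
  assert (Ha : 0 < Rabs h) by (apply Rabs_pos_lt, Hh).
  unfold Rdiv; rewrite Rabs_mult, Rabs_inv.
  apply Rmult_lt_reg_r with (Rabs h); [exact Ha|].
  rewrite Rmult_assoc, Rinv_l, Rmult_1_r by lra.
  eapply Rle_lt_trans; [apply H|].
  rewrite <- pow2_abs.
  replace (M * Rabs h ^ 2) with ((M * Rabs h) * Rabs h) by ring.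
  apply Rmult_lt_compat_r; [exact Ha|].
  apply Rmult_lt_reg_r with (/ M); [apply Rinv_0_lt_compat, HM|].
  replace (M * Rabs h * / M) with (Rabs h) by (field; lra).
  exact Hhd.
Qed.

Lemma is_derive_flat k x :
  is_derive (flat k) x (- INR k * flat (S k) x + flat (S (S k)) x).
Proof.
  destruct (Rtotal_order x 0) as [H|[H|H]].
  - rewrite !flat_nonpos by lra.
    apply is_derive_ext_loc with (fun _ => 0).
    + apply filter_imp with (fun t => t < 0); [|apply open_lt, H].
      intros t Ht; rewrite flat_nonpos; lra.
    + replace (- INR k * 0 + 0) with 0 by ring.
      apply (is_derive_const 0 x).
  - subst x; rewrite !flat_nonpos by lra.
    replace (- INR k * 0 + 0) with 0 by ring.
    destruct (flat_le_sqr k) as (M & HM & Hf).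
    apply (is_derive_0_of_le_sqr _ M); assumption.
  - apply is_derive_ext_loc with (fun x => (/ x) ^ k * exp (- / x)).
    + apply filter_imp with (fun t => 0 < t); [|apply open_gt, H].
      intros t Ht; unfold flat; destruct Rle_dec; lra.
    + unfold flat; destruct Rle_dec; [lra|].
      auto_derive; [lra|].
      destruct k; [simpl; field; lra|].
      replace (pred (S k)) with k by reflexivity.
      rewrite <- !tech_pow_Rmult. field; lra.
Qed.

(** Closing a set of functions under differentiation is a convenient form of
    induction: the n-th derivative need not be known explicitly. *)
Lemma smooth_of_derive_closed (P : (R -> R) -> Prop) :
  (forall f, P f -> exists g, P g /\ forall x, is_derive f x (g x)) ->
  forall f, P f -> smooth f.
Proof.
  intros HP f Hf.
  assert (H : forall n, exists g, P g /\ forall x, Derive_n f n x = g x).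
  { induction n as [|n (g & Pg & Hg)]; [exists f; auto|].
    destruct (HP g Pg) as (h & Ph & Hh); exists h; split; [exact Ph|].
    intros x; simpl; rewrite (Derive_ext _ g) by exact Hg.
    apply is_derive_unique, Hh. }
  intros [|n] x; [exact I|]; simpl.
  destruct (H n) as (g & Pg & Hg); destruct (HP g Pg) as (h & _ & Hh).
  apply ex_derive_ext with g; [intros; symmetry; apply Hg|].
  exists (h x); apply Hh.
Qed.

(** The linear span of all products of flat functions at p and at q is stable
    under differentiation, while the single products are not. *)
Inductive bump_span (p q : R) : (R -> R) -> Prop :=
| bump_span_base j k : bump_span p q (fun x => flat j (x - p) * flat k (q - x))
| bump_span_comb a b f g : bump_span p q f -> bump_span p q g ->
    bump_span p q (fun x => a * f x + b * g x).

Lemma bump_span_derive p q f : bump_span p q f ->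
  exists g, bump_span p q g /\ forall x, is_derive f x (g x).
Proof.
  induction 1 as [j k|a b f g _ (f' & Pf & Hf) _ (g' & Pg & Hg)].
  - eexists; split.
    + apply (bump_span_comb p q 1 1).
      * apply (bump_span_comb p q (- INR j) 1);
          [apply (bump_span_base p q (S j) k) | apply (bump_span_base p q (S (S j)) k)].
      * apply (bump_span_comb p q (INR k) (-1));
          [apply (bump_span_base p q j (S k)) | apply (bump_span_base p q j (S (S k)))].
    + intros x.
      assert (H1 : is_derive (fun x => flat j (x - p)) x
                     (- INR j * flat (S j) (x - p) + flat (S (S j)) (x - p))).
      { evar_last.
        - apply (is_derive_comp (flat j) (fun x => x - p)); [apply is_derive_flat|].
          auto_derive; [exact I | reflexivity].
        - unfold scal; simpl; unfold mult; simpl; ring. }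
      assert (H2 : is_derive (fun x => flat k (q - x)) x
                     (- (- INR k * flat (S k) (q - x) + flat (S (S k)) (q - x)))).
      { evar_last.
        - apply (is_derive_comp (flat k) (fun x => q - x)); [apply is_derive_flat|].
          auto_derive; [exact I | reflexivity].
        - unfold scal; simpl; unfold mult; simpl; ring. }
      evar_last.
      * apply (is_derive_mult (fun x => flat j (x - p)) (fun x => flat k (q - x)));
          [exact H1 | exact H2 | intros; apply Rmult_comm].
      * unfold plus, mult; simpl; ring.
  - exists (fun x => a * f' x + b * g' x); split.
    + now apply bump_span_comb.
    + intros x; apply (is_derive_plus (fun x => a * f x) (fun x => b * g x));
        apply is_derive_scal; auto.
Qed.

Definition bump (p q x : R) : R := flat 0 (x - p) * flat 0 (q - x).

Lemma bump_smooth p q : smooth (bump p q).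
Proof.
  apply (smooth_of_derive_closed (bump_span p q)).
  - apply bump_span_derive.
  - apply (bump_span_base p q 0 0).
Qed.

Lemma bump_out p q x : x <= p \/ q <= x -> bump p q x = 0.
Proof.
  unfold bump; intros [H|H].
  - rewrite (flat_nonpos 0 (x - p)) by lra; ring.
  - rewrite (flat_nonpos 0 (q - x)) by lra; ring.
Qed.

Lemma bump_in p q x : p < x < q -> 0 < bump p q x.
Proof. intros H; apply Rmult_lt_0_compat; apply flat_pos; lra. Qed.

(** * The Schwartz space *)

Lemma seminorm_finite n f :
  is_finite (schwartz_seminorm n f) <->
  exists M, forall x j, (j <= n)%nat ->
    (1 + Rabs x ^ 2) ^ n * Cmod (CDerive_n f j x) <= M.
Proof.
  unfold schwartz_seminorm; set (E := fun y => _).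
  assert (H0 : E ((1 + Rabs 0 ^ 2) ^ n * Cmod (CDerive_n f 0 0))).
  { exists 0, 0%nat; split; [lia | reflexivity]. }
  destruct (Lub_Rbar_correct E) as [Hub Hl].
  split.
  - intros Hf; exists (real (Lub_Rbar E)); intros x j Hj.
    assert (H : Rbar_le ((1 + Rabs x ^ 2) ^ n * Cmod (CDerive_n f j x)) (Lub_Rbar E)).
    { apply Hub; exists x, j; auto. }
    rewrite <- Hf in H; exact H.
  - intros (M & HM).
    assert (H1 : Rbar_le (Lub_Rbar E) M).
    { apply Hl; intros y (x & j & Hj & ->); apply HM, Hj. }
    assert (H2 := Hub _ H0).
    destruct (Lub_Rbar E); simpl in *; [reflexivity | easy | easy].
Qed.

Lemma smooth_derive_n f n x : smooth f -> is_derive (Derive_n f n) x (Derive_n f (S n) x).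
Proof. intros H; apply Derive_correct, (H (S n) x). Qed.

Lemma smooth_is_derive f x : smooth f -> is_derive f x (Derive f x).
Proof. intros H; apply (smooth_derive_n f 0 x H). Qed.

Lemma smooth_continuity f n : smooth f -> continuity (Derive_n f n).
Proof.
  intros H x; apply continuity_pt_filterlim.
  apply (ex_derive_continuous (Derive_n f n)).
  eexists; apply smooth_derive_n, H.
Qed.

Lemma smooth_const c : smooth (fun _ => c).
Proof. intros [|n] x; [exact I | apply ex_derive_n_const]. Qed.

Lemma Derive_n_support f p q j x :
  (forall x, x <= p \/ q <= x -> f x = 0) -> x < p \/ q < x -> Derive_n f j x = 0.
Proof.
  intros Hf Hx; rewrite (Derive_n_ext_loc f (fun _ => 0)).
  - destruct j; [reflexivity | apply Derive_n_const].
  - destruct Hx as [Hx|Hx].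
    + apply filter_imp with (fun t => t < p); [|apply open_lt, Hx].
      intros t Ht; apply Hf; lra.
    + apply filter_imp with (fun t => q < t); [|apply open_gt, Hx].
      intros t Ht; apply Hf; lra.
Qed.

Lemma compact_support_bounded f p q : p <= q -> continuity f ->
  (forall x, x < p \/ q < x -> f x = 0) -> exists M, forall x, f x <= M.
Proof.
  intros Hpq Hc Hf.
  destruct (continuity_ab_maj f p q Hpq) as (m & Hm & _); [intros; apply Hc|].
  exists (Rmax (f m) 0); intros x.
  destruct (Rlt_le_dec x p); [rewrite Hf by lra; apply Rmax_r|].
  destruct (Rlt_le_dec q x); [rewrite Hf by lra; apply Rmax_r|].
  eapply Rle_trans; [apply Hm; lra | apply Rmax_l].
Qed.

Lemma schwartz_of_compact_support f p q : p <= q -> smooth f ->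
  (forall x, x <= p \/ q <= x -> f x = 0) ->
  exists F : schwartz, forall x, F x = RtoC (f x).
Proof.
  intros Hpq Hs Hf.
  assert (Hsm : Csmooth (fun x => RtoC (f x))).
  { split; [exact Hs | exact (smooth_const 0)]. }
  assert (Hfin : forall n, is_finite (schwartz_seminorm n (fun x => RtoC (f x)))).
  { intros n; apply seminorm_finite.
    assert (Hder : forall j x, CDerive_n (fun x => RtoC (f x)) j x = RtoC (Derive_n f j x)).
    { intros j x; unfold CDerive_n, RtoC; simpl; f_equal.
      destruct j; [reflexivity | apply Derive_n_const]. }
    assert (Hj : forall j, exists M, forall x,
              (1 + Rabs x ^ 2) ^ n * Rabs (Derive_n f j x) <= M).
    { intros j; apply compact_support_bounded with p q; [exact Hpq| |].
      - intros x.
        apply (continuity_pt_mult (fun x => (1 + Rabs x ^ 2) ^ n)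
                 (fun x => Rabs (Derive_n f j x))).
        + apply continuity_pt_ext with (fun x => (1 + x ^ 2) ^ n);
            [intros; now rewrite pow2_abs|].
          apply derivable_continuous_pt, ex_derive_Reals_0.
          auto_derive; exact I.
        + apply (continuity_pt_comp (Derive_n f j) Rabs);
            [apply smooth_continuity, Hs | apply Rcontinuity_abs].
      - intros x Hx; rewrite (Derive_n_support f p q j x Hf Hx), Rabs_R0; ring. }
    (* the weight keeps the exponent n while the bound on the order grows *)
    assert (Hm : forall m, exists M, forall x j, (j <= m)%nat ->
              (1 + Rabs x ^ 2) ^ n * Rabs (Derive_n f j x) <= M).
    { induction m as [|m (M & HM)].
      - destruct (Hj 0%nat) as (M & HM); exists M; intros x j H.
        replace j with 0%nat by lia; apply HM.
      - destruct (Hj (S m)) as (M' & HM'); exists (Rmax M M'); intros x j H.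
        destruct (Nat.eq_dec j (S m)) as [->|Hne].
        + eapply Rle_trans; [apply HM' | apply Rmax_r].
        + eapply Rle_trans; [apply HM; lia | apply Rmax_l]. }
    destruct (Hm n) as (M & HM); exists M; intros x j H.
    rewrite Hder, Cmod_R; apply HM, H. }
  exists (Schwartz _ Hsm Hfin); reflexivity.
Qed.

Lemma smooth_comb f g c : smooth f -> smooth g -> smooth (fun x => f x + c * g x).
Proof.
  intros Hf Hg n x; apply (ex_derive_n_plus f (fun x => c * g x)).
  - apply filter_forall; intros y k _; apply Hf.
  - apply filter_forall; intros y k _; apply ex_derive_n_scal_l, Hg.
Qed.

Lemma Derive_n_comb f g c n x : smooth f -> smooth g ->
  Derive_n (fun x => f x + c * g x) n x = Derive_n f n x + c * Derive_n g n x.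
Proof.
  intros Hf Hg; rewrite (Derive_n_plus f (fun x => c * g x)).
  - now rewrite Derive_n_scal_l.
  - apply filter_forall; intros y k _; apply Hf.
  - apply filter_forall; intros y k _; apply ex_derive_n_scal_l, Hg.
Qed.

Lemma schwartz_comb (f g : schwartz) (c : R) :
  exists h : schwartz, forall x, h x = Cplus (f x) (Cmult (RtoC c) (g x)).
Proof.
  set (h := fun x => ((Re (f x) + c * Re (g x), Im (f x) + c * Im (g x)) : C)).
  destruct (schwartz_smooth f) as [f1 f2], (schwartz_smooth g) as [g1 g2].
  assert (Hsm : Csmooth h).
  { split; [exact (smooth_comb _ _ c f1 g1) | exact (smooth_comb _ _ c f2 g2)]. }
  assert (Hfin : forall n, is_finite (schwartz_seminorm n h)).
  { intros n.
    destruct (proj1 (seminorm_finite n f) (schwartz_decay f n)) as (M & HM).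
    destruct (proj1 (seminorm_finite n g) (schwartz_decay g n)) as (N & HN).
    apply seminorm_finite; exists (M + Rabs c * N); intros x j Hj.
    assert (E : CDerive_n h j x
      = Cplus (CDerive_n f j x) (Cmult (RtoC c) (CDerive_n g j x))).
    { unfold CDerive_n, h; simpl.
      rewrite (Derive_n_comb (fun t => Re (f t)) (fun t => Re (g t))) by assumption.
      rewrite (Derive_n_comb (fun t => Im (f t)) (fun t => Im (g t))) by assumption.
      unfold Cplus, Cmult, RtoC; simpl; f_equal; ring. }
    rewrite E.
    assert (W : 0 <= (1 + Rabs x ^ 2) ^ n).
    { apply pow_le; generalize (pow2_ge_0 (Rabs x)); lra. }
    eapply Rle_trans; [apply Rmult_le_compat_l; [exact W | apply Cmod_triangle]|].
    rewrite Cmod_mult, Cmod_R, Rmult_plus_distr_l; apply Rplus_le_compat.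
    - apply HM, Hj.
    - rewrite <- Rmult_assoc, (Rmult_comm _ (Rabs c)), Rmult_assoc.
      apply Rmult_le_compat_l; [apply Rabs_pos | apply HN, Hj]. }
  exists (Schwartz _ Hsm Hfin); intros x; simpl; unfold h.
  unfold Re, Im, Cplus, Cmult, RtoC; simpl; f_equal; ring.
Qed.

Lemma CDerive_n_0 f x : CDerive_n f 0 x = f x.
Proof. unfold CDerive_n; simpl; unfold Re, Im; now destruct (f x). Qed.

Lemma schwartz_bounded (f : schwartz) : exists M, forall x, Cmod (f x) <= M.
Proof.
  destruct (proj1 (seminorm_finite 0 f) (schwartz_decay f 0)) as (M & HM).
  exists M; intros x; specialize (HM x 0%nat (Nat.le_refl _)).
  rewrite CDerive_n_0 in HM; simpl in HM; lra.
Qed.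

Lemma schwartz_vanishes (f : schwartz) eps : 0 < eps ->
  exists A, forall x, A < Rabs x -> Cmod (f x) < eps.
Proof.
  intros He.
  destruct (proj1 (seminorm_finite 1 f) (schwartz_decay f 1)) as (M & HM).
  assert (HM0 : 0 <= M).
  { eapply Rle_trans; [|apply (HM 0 0%nat); lia].
    apply Rmult_le_pos; [|apply Cmod_ge_0].
    apply pow_le; generalize (pow2_ge_0 (Rabs 0)); lra. }
  exists (Rmax 1 (M / eps)); intros x Hx.
  assert (H1 := Rle_lt_trans _ _ _ (Rmax_l _ _) Hx).
  assert (H2 := Rle_lt_trans _ _ _ (Rmax_r _ _) Hx).
  specialize (HM x 0%nat ltac:(lia)); rewrite CDerive_n_0, pow_1 in HM.
  assert (H3 : M < Rabs x * eps).
  { apply Rmult_lt_reg_r with (/ eps); [apply Rinv_0_lt_compat, He|].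
    replace (Rabs x * eps * / eps) with (Rabs x) by (field; lra); exact H2. }
  assert (H4 : Rabs x <= Rabs x ^ 2) by (simpl; nra).
  apply Rnot_le_lt; intros Hc; nra.
Qed.

(** * Orbits of an increasing map *)

(** Monotone orbits converge in the extended line, and since the orbit of a
    point between x and psi x is squeezed between the orbit of x and its shift,
    the whole segment is attracted to the same end. *)
Lemma iter_segment_limit (psi : R -> R) x :
  (forall a b, a < b -> psi a < psi b) -> continuity psi ->
  exists l : Rbar, (forall L : R, l = Finite L -> psi L = L) /\
    forall y, Rmin x (psi x) <= y <= Rmax x (psi x) ->
      is_lim_seq (fun n => Nat.iter n psi y) l.
Proof.
  intros Hinc Hc.
  assert (Hle : forall n a b, a <= b -> Nat.iter n psi a <= Nat.iter n psi b).
  { induction n as [|n IH]; intros a b Hab; [exact Hab|].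
    destruct (IH a b Hab) as [Hlt|Heq]; simpl;
      [left; apply Hinc, Hlt | right; now f_equal]. }
  set (u := fun n => Nat.iter n psi x).
  assert (HS : forall n, u (S n) = Nat.iter n psi (psi x))
    by (intros n; apply Nat.iter_succ_r).
  assert (Hex : ex_lim_seq u).
  { destruct (Rle_lt_dec x (psi x)) as [H|H].
    - apply ex_lim_seq_incr; intros n; rewrite HS; apply Hle, H.
    - apply ex_lim_seq_decr; intros n; rewrite HS; apply Hle; lra. }
  destruct Hex as [l Hl]; exists l; split.
  - intros L ->.
    assert (H1 := is_lim_seq_continuous psi u L (Hc L) Hl).
    assert (H2 := proj1 (is_lim_seq_incr_1 u L) Hl).
    apply is_lim_seq_unique in H1; apply is_lim_seq_unique in H2.
    assert (H3 : Finite (psi L) = Finite L) by (rewrite <- H1, <- H2; reflexivity).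
    now injection H3.
  - intros y Hy.
    assert (Hl' : is_lim_seq (fun n => Nat.iter n psi (psi x)) l).
    { apply is_lim_seq_ext with (fun n => u (S n)); [exact HS|].
      apply (is_lim_seq_incr_1 u l), Hl. }
    revert Hy; unfold Rmin, Rmax; destruct (Rle_dec x (psi x)) as [Hx|Hx]; intros Hy.
    + apply is_lim_seq_le_le with u (fun n => Nat.iter n psi (psi x));
        [|exact Hl | exact Hl'].
      intros n; split; apply Hle; lra.
    + apply is_lim_seq_le_le with (fun n => Nat.iter n psi (psi x)) u;
        [|exact Hl' | exact Hl].
      intros n; split; apply Hle; lra.
Qed.

(** An invariant function takes along an orbit the value at its end: a fixed
    point, or infinity, where the function vanishes. *)
Lemma invariant_on_segment (psi G : R -> R) x :
  (forall a b, a < b -> psi a < psi b) -> continuity psi -> continuity G ->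
  (forall eps, 0 < eps -> exists A, forall y, A < Rabs y -> Rabs (G y) < eps) ->
  (forall y, G (psi y) = G y) ->
  exists v, (forall y, Rmin x (psi x) <= y <= Rmax x (psi x) -> G y = v) /\
    (v = 0 \/ exists L, psi L = L /\ v = G L).
Proof.
  intros Hinc Hc HG Hv Hi.
  destruct (iter_segment_limit psi x Hinc Hc) as (l & Hfix & Hl).
  assert (Hit : forall n y, G (Nat.iter n psi y) = G y).
  { induction n as [|n IH]; intros y; [reflexivity|]; simpl; now rewrite Hi. }
  assert (Hfar : forall y, (forall A, exists n, A < Rabs (Nat.iter n psi y)) -> G y = 0).
  { intros y Hy; apply NNPP; intros Hne.
    destruct (Hv (Rabs (G y)) (Rabs_pos_lt _ Hne)) as [A HA].
    destruct (Hy A) as [n Hn]; specialize (HA _ Hn); rewrite Hit in HA; lra. }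
  destruct l as [L| |].
  - exists (G L); split; [|right; exists L; auto].
    intros y Hy; specialize (Hl y Hy).
    assert (H1 := is_lim_seq_continuous G _ L (HG L) Hl).
    apply is_lim_seq_ext with (v := fun _ => G y) in H1; [|intros n; apply Hit].
    apply is_lim_seq_unique in H1; rewrite Lim_seq_const in H1.
    now injection H1.
  - exists 0; split; [|now left]; intros y Hy; apply Hfar; intros A.
    destruct (proj2 (is_lim_seq_spec _ _) (Hl y Hy) A) as [n Hn]; exists n.
    eapply Rlt_le_trans; [apply (Hn n), Nat.le_refl | apply Rle_abs].
  - exists 0; split; [|now left]; intros y Hy; apply Hfar; intros A.
    destruct (proj2 (is_lim_seq_spec _ _) (Hl y Hy) (- A)) as [n Hn]; exists n.
    specialize (Hn n (Nat.le_refl _)).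
    rewrite <- Rabs_Ropp; eapply Rlt_le_trans; [|apply Rle_abs]; lra.
Qed.

(** Local constancy on a dense open set does not make a continuous function
    constant; here the derivative is continuous, so it vanishes everywhere. *)
Lemma invariant_zero_of_sparse_fixpoints (psi G G' : R -> R) :
  (forall a b, a < b -> psi a < psi b) -> continuity psi ->
  (forall x, is_derive G x (G' x)) -> continuity G' ->
  (forall eps, 0 < eps -> exists A, forall y, A < Rabs y -> Rabs (G y) < eps) ->
  (forall y, G (psi y) = G y) ->
  (forall t, ~ locally t (fun s => psi s = s)) ->
  forall x, G x = 0.
Proof.
  intros Hinc Hc HG HG' Hv Hi Hsp.
  assert (HGc : continuity G).
  { intros x; apply continuity_pt_filterlim, (ex_derive_continuous G).
    exists (G' x); apply HG. }
  assert (Hz : forall t, G' t = 0).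
  { intros t; apply NNPP; intros Ht.
    assert (Hloc : locally t (fun s => G' s <> 0)).
    { apply (proj1 (continuity_pt_filterlim G' t) (HG' t)
               (fun y => y <> 0)), open_neq, Ht. }
    apply locally_locally in Hloc.
    apply (Hsp t); revert Hloc; apply filter_imp; intros s [eps Hs].
    apply NNPP; intros Hne.
    destruct (invariant_on_segment psi G s Hinc Hc HGc Hv Hi) as (v & Hconst & _).
    set (d := Rmin (eps / 2) (Rabs (psi s - s))).
    assert (Hd : 0 < d).
    { apply Rmin_pos; [generalize (cond_pos eps); lra | apply Rabs_pos_lt; lra]. }
    assert (Hd1 : d < eps).
    { eapply Rle_lt_trans; [apply Rmin_l | generalize (cond_pos eps); lra]. }
    assert (Hd2 : d <= Rabs (psi s - s)) by apply Rmin_r.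
    (* z is between s and psi s, where G is constant, and within eps of s, where
       G' does not vanish: the mean value theorem then gives a contradiction *)
    assert (Hex : exists z, z <> s /\ Rmin s (psi s) <= z <= Rmax s (psi s) /\
                    forall c, Rmin s z <= c <= Rmax s z -> Rabs (c - s) <= d).
    { destruct (Rlt_le_dec s (psi s)) as [H|H].
      - rewrite Rabs_pos_eq in Hd2 by lra.
        exists (s + d); split; [lra|]; split.
        + rewrite Rmin_left, Rmax_right by lra; lra.
        + intros c; rewrite Rmin_left, Rmax_right by lra; intros Hcs.
          rewrite Rabs_pos_eq; lra.
      - rewrite Rabs_left in Hd2 by lra.
        exists (s - d); split; [lra|]; split.
        + rewrite Rmin_right, Rmax_left by lra; lra.
        + intros c; rewrite Rmin_right, Rmax_left by lra; intros Hcs.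
          apply Rabs_le; lra. }
    destruct Hex as (z & Hzs & Hz & Hnear).
    destruct (MVT_gen G s z G') as (c & Hcs & Heq);
      [intros; apply HG | intros; apply HGc|].
    rewrite (Hconst z Hz), (Hconst s) in Heq
      by (split; [apply Rmin_l | apply Rmax_l]).
    apply (Hs c).
    - change (Rabs (c - s) < eps); specialize (Hnear c Hcs); lra.
    - apply Rmult_eq_reg_r with (z - s); lra. }
  intros x; apply NNPP; intros Hx.
  destruct (Hv (Rabs (G x)) (Rabs_pos_lt _ Hx)) as [A HA].
  set (b := Rmax x (Rabs A) + 1).
  assert (Hxb : x < b) by (unfold b; generalize (Rmax_l x (Rabs A)); lra).
  assert (Hb : A < Rabs b).
  { apply Rlt_le_trans with b; [|apply Rle_abs].
    unfold b; generalize (Rmax_r x (Rabs A)) (Rle_abs A); lra. }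
  assert (E : G x = G b).
  { apply (eq_is_derive G x b); [|exact Hxb].
    intros t _; evar_last; [apply HG | apply Hz]. }
  specialize (HA b Hb); rewrite <- E in HA; lra.
Qed.

(** * Symbols and eigenfunctions *)

Lemma symbol_continuity (phi : symbol) : continuity phi.
Proof. exact (smooth_continuity phi 0 (symbol_smooth phi)). Qed.

(** A bump that is bounded below on [-B,B] turns into a Schwartz function under
    composition, so phi cannot return to [-B,B] far away. *)
Lemma symbol_proper (phi : symbol) B : 0 <= B ->
  exists A, forall x, A < Rabs x -> B < Rabs (phi x).
Proof.
  intros HB; set (f := bump (- B - 1) (B + 1)).
  assert (Hs : smooth f) by apply bump_smooth.
  destruct (schwartz_of_compact_support f (- B - 1) (B + 1)) as [F HF];
    [lra | exact Hs | intros x Hx; apply bump_out, Hx|].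
  destruct (continuity_ab_min f (- B) B) as (m & Hm & Hmi); [lra| |].
  { intros c _; apply (smooth_continuity f 0 Hs). }
  destruct (schwartz_vanishes (comp_op phi F) (f m)) as [A HA].
  { apply bump_in; lra. }
  exists A; intros x Hx; apply Rnot_le_lt; intros Hle.
  specialize (HA x Hx); rewrite comp_opE, HF, Cmod_R in HA.
  specialize (Hm (phi x) (proj1 (Rabs_le_between _ _) Hle)).
  generalize (Rle_abs (f (phi x))); lra.
Qed.

Lemma symbol_surjective (phi : symbol) : strict_decreasing phi ->
  forall y, exists x, phi x = y.
Proof.
  intros Hd y.
  set (B := Rmax (Rabs (phi 0)) (Rabs y)).
  assert (H0 : Rabs (phi 0) <= B) by apply Rmax_l.
  assert (Hy : Rabs y <= B) by apply Rmax_r.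
  destruct (symbol_proper phi B) as [A HA].
  { eapply Rle_trans; [apply Rabs_pos | exact Hy]. }
  set (b := Rabs A + 1).
  assert (Hb : 0 < b) by (unfold b; generalize (Rabs_pos A); lra).
  assert (HAb : A < b) by (unfold b; generalize (Rle_abs A); lra).
  assert (H1 := HA b); rewrite Rabs_pos_eq in H1 by lra; specialize (H1 HAb).
  assert (H2 := HA (- b)).
  rewrite Rabs_Ropp, Rabs_pos_eq in H2 by lra; specialize (H2 HAb).
  assert (H3 := Hd 0 b Hb); assert (H4 := Hd (- b) 0 ltac:(lra)).
  apply Rabs_le_between in H0, Hy.
  assert (H5 : phi b < - B).
  { revert H1; unfold Rabs; destruct Rcase_abs; lra. }
  assert (H6 : B < phi (- b)).
  { revert H2; unfold Rabs; destruct Rcase_abs; lra. }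
  destruct (IVT_gen phi (- b) b y) as (x & _ & Hx); [apply symbol_continuity| |].
  - rewrite Rmin_right, Rmax_left by lra; lra.
  - now exists x.
Qed.

(** Following an orbit forwards a factor r > 1 contradicts boundedness; following
    it backwards, a factor r < 1 forces zero. *)
Lemma bounded_scaling_factor (phi N : R -> R) r M :
  (forall y, exists x, phi x = y) -> 0 <= r -> (forall x, 0 <= N x <= M) ->
  (forall x, N (phi x) = r * N x) -> (exists x, 0 < N x) -> r = 1.
Proof.
  intros Hsur Hr HN Heq [x0 Hx0].
  destruct (Rtotal_order r 1) as [H|[H|H]]; [|exact H|]; exfalso.
  - assert (Hn : forall n x, N x <= r ^ n * M).
    { induction n as [|n IH]; intros x; [simpl; generalize (HN x); lra|].
      destruct (Hsur x) as [y <-]; rewrite Heq; simpl; rewrite Rmult_assoc.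
      apply Rmult_le_compat_l; [exact Hr | apply IH]. }
    assert (Hl : is_lim_seq (fun n => r ^ n * M) 0).
    { replace (Finite 0) with (Rbar_mult 0 M)
        by (simpl; f_equal; ring).
      apply is_lim_seq_scal_r, is_lim_seq_geom; rewrite Rabs_pos_eq; lra. }
    assert (H1 := is_lim_seq_le _ _ _ _ (fun n => Hn n x0)
                    (is_lim_seq_const (N x0)) Hl).
    simpl in H1; lra.
  - assert (Hn : forall n, N (Nat.iter n phi x0) = r ^ n * N x0).
    { induction n as [|n IH]; [simpl; ring|].
      simpl; rewrite Heq, IH; ring. }
    destruct (proj2 (is_lim_seq_spec _ _) (is_lim_seq_geom_p r H) (M / N x0))
      as [n HL].
    specialize (HL n (Nat.le_refl _)); specialize (Hn n).
    apply Rmult_lt_compat_r with (r := N x0) in HL; [|exact Hx0].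
    unfold Rdiv in HL; rewrite Rmult_assoc, Rinv_l, Rmult_1_r in HL by lra.
    generalize (HN (Nat.iter n phi x0)); lra.
Qed.

Definition sqnorm (f : schwartz) (x : R) : R := Re (f x) ^ 2 + Im (f x) ^ 2.

Lemma sqnorm_Cmod f x : sqnorm f x = Cmod (f x) ^ 2.
Proof. symmetry; apply Cmod2_alt. Qed.

Lemma sqnorm_eq_0 f x : sqnorm f x = 0 -> f x = RtoC 0.
Proof.
  rewrite sqnorm_Cmod; intros H; apply Cmod_eq_0.
  simpl in H; rewrite Rmult_1_r in H; apply Rmult_integral in H; tauto.
Qed.

Lemma sqnorm_derive (f : schwartz) : exists g,
  (forall x, is_derive (sqnorm f) x (g x)) /\ continuity g.
Proof.
  destruct (schwartz_smooth f) as [Hr Hi].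
  set (a := fun t => Re (f t)) in *; set (b := fun t => Im (f t)) in *.
  exists (fun x => 2 * a x * Derive a x + 2 * b x * Derive b x); split.
  - intros x; unfold sqnorm.
    change (is_derive (fun x => a x ^ 2 + b x ^ 2) x
              (2 * a x * Derive a x + 2 * b x * Derive b x)).
    assert (Ha := smooth_is_derive a x Hr); assert (Hb := smooth_is_derive b x Hi).
    auto_derive.
    + repeat split; eexists; eassumption.
    + change (fun x0 => a x0) with a; change (fun x0 => b x0) with b; ring.
  - assert (Hp : forall u, smooth u ->
               continuity (fun x => 2 * u x * Derive u x)).
    { intros u Hu x.
      apply (continuity_pt_mult (fun x => 2 * u x) (Derive u));
        [apply (continuity_pt_scal u) |].
      - apply (smooth_continuity u 0 Hu).
      - apply (smooth_continuity u 1 Hu). }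
    intros x; apply (continuity_pt_plus (fun x => 2 * a x * Derive a x)
      (fun x => 2 * b x * Derive b x)); now apply Hp.
Qed.

Lemma sqnorm_vanishes (f : schwartz) eps : 0 < eps ->
  exists A, forall y, A < Rabs y -> Rabs (sqnorm f y) < eps.
Proof.
  intros He; destruct (schwartz_vanishes f (Rmin 1 eps)) as [A HA];
    [apply Rmin_pos; lra|].
  exists A; intros y Hy; specialize (HA y Hy).
  assert (H0 := Cmod_ge_0 (f y)).
  assert (H1 := Rlt_le_trans _ _ _ HA (Rmin_l _ _)).
  assert (H2 := Rlt_le_trans _ _ _ HA (Rmin_r _ _)).
  rewrite sqnorm_Cmod, Rabs_pos_eq by apply pow2_ge_0.
  simpl; nra.
Qed.

Section Eigenfunction.

Variables (phi : symbol) (f : schwartz) (lambda : C).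
Hypothesis hphi : strict_decreasing phi.
Hypothesis feig : forall x, f (phi x) = Cmult lambda (f x).
Hypothesis fne0 : exists x, f x <> RtoC 0.

Let psi := fun x => phi (phi x).

Lemma square_increasing a b : a < b -> psi a < psi b.
Proof. intros H; apply hphi, hphi, H. Qed.

Lemma square_continuity : continuity psi.
Proof. apply (continuity_comp phi phi); apply symbol_continuity. Qed.

Lemma eigenvalue_Cmod : Cmod lambda = 1.
Proof.
  destruct (schwartz_bounded f) as [M HM].
  apply (bounded_scaling_factor phi (fun x => Cmod (f x)) _ M).
  - apply symbol_surjective, hphi.
  - apply Cmod_ge_0.
  - intros x; split; [apply Cmod_ge_0 | apply HM].
  - intros x; now rewrite feig, Cmod_mult.
  - destruct fne0 as [x Hx]; exists x; apply Cmod_gt_0, Hx.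
Qed.

Lemma sqnorm_invariant x : sqnorm f (psi x) = sqnorm f x.
Proof.
  rewrite !sqnorm_Cmod; unfold psi.
  rewrite !feig, !Cmod_mult, eigenvalue_Cmod; ring.
Qed.

Lemma square_fixpoints_interior : exists t, locally t (fun s => phi (phi s) = s).
Proof.
  apply NNPP; intros Hno.
  destruct (sqnorm_derive f) as (g & Hg & Hgc).
  destruct fne0 as [x Hx]; apply Hx, sqnorm_eq_0.
  apply (invariant_zero_of_sparse_fixpoints psi (sqnorm f) g).
  - exact square_increasing.
  - exact square_continuity.
  - exact Hg.
  - exact Hgc.
  - apply sqnorm_vanishes.
  - exact sqnorm_invariant.
  - intros t Ht; apply Hno; now exists t.
Qed.

(** If the square of lambda were not 1, then f would vanish at the fixed points of
    psi, hence everywhere, since orbits end there or at infinity. *)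
Lemma eigenvalue_sqr : Cmult lambda lambda = RtoC 1.
Proof.
  apply NNPP; intros Hne.
  destruct fne0 as [x Hx]; apply Hx, sqnorm_eq_0.
  destruct (sqnorm_derive f) as (g & Hg & _).
  destruct (invariant_on_segment psi (sqnorm f) x) as (v & Hv & Hend).
  - exact square_increasing.
  - exact square_continuity.
  - intros y; apply continuity_pt_filterlim, (ex_derive_continuous (sqnorm f)).
    exists (g y); apply Hg.
  - apply sqnorm_vanishes.
  - exact sqnorm_invariant.
  - rewrite (Hv x) by (split; [apply Rmin_l | apply Rmax_l]).
    destruct Hend as [Hend | (L & HL & ->)]; [exact Hend|].
    assert (H0 : f L = RtoC 0).
    { assert (E : f L = Cmult (Cmult lambda lambda) (f L)).
      { rewrite <- HL at 1; unfold psi; rewrite !feig; ring. }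
      apply NNPP; intros HfL.
      assert (Hd : Cminus (Cmult lambda lambda) (RtoC 1) <> RtoC 0).
      { intros Hd; apply Hne.
        rewrite <- (Cplus_0_l (RtoC 1)), <- Hd; ring. }
      apply (Cmult_neq_0 _ _ Hd HfL).
      replace (Cmult (Cminus (Cmult lambda lambda) (RtoC 1)) (f L))
        with (Cminus (Cmult (Cmult lambda lambda) (f L)) (f L)) by ring.
      rewrite <- E; ring. }
    rewrite sqnorm_Cmod, H0, Cmod_0; ring.
Qed.

Lemma eigenvalue_pm1 : lambda = RtoC (-1) \/ lambda = RtoC 1.
Proof.
  apply NNPP; intros Hno; apply not_or_and in Hno; destruct Hno as [H1 H2].
  apply (Cmult_neq_0 (Cplus lambda (RtoC 1)) (Cminus lambda (RtoC 1))).
  - intros H; apply H1.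
    replace lambda with (Cminus (Cplus lambda (RtoC 1)) (RtoC 1)) by ring.
    rewrite H; replace (-1) with (Ropp 1) by ring; rewrite RtoC_opp; ring.
  - intros H; apply H2.
    replace lambda with (Cplus (Cminus lambda (RtoC 1)) (RtoC 1)) by ring.
    rewrite H; ring.
  - replace (Cmult (Cplus lambda (RtoC 1)) (Cminus lambda (RtoC 1)))
      with (Cminus (Cmult lambda lambda) (RtoC 1)) by ring.
    rewrite eigenvalue_sqr; ring.
Qed.

End Eigenfunction.

(** A bump u on a small interval I of fixed points of phi o phi is invariant
    under phi o phi, because this map is injective and fixes I pointwise. Hence
    u + c (u o phi) is an eigenfunction for c = 1 and c = -1; it is nonzero at
    the centre t of I, as I can be chosen so small that phi t is outside I. *)
Lemma pm1_eigenvalue (phi : symbol) (c : R) :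
  strict_decreasing phi -> c * c = 1 ->
  (exists t, locally t (fun s => phi (phi s) = s)) ->
  point_spectrum (comp_op phi) (RtoC c).
Proof.
  intros hphi Hc Hint.
  (* phi has at most one fixed point, so the centre can be moved away from it *)
  assert (Ht : exists t, phi t <> t /\ locally t (fun s => phi (phi s) = s)).
  { destruct Hint as [t Ht].
    destruct (Req_dec (phi t) t) as [E|E]; [|now exists t].
    apply locally_locally in Ht; destruct Ht as [eps Heps].
    assert (He := cond_pos eps).
    exists (t + eps / 2); split.
    - assert (H := hphi t (t + eps / 2) ltac:(lra)); lra.
    - apply Heps; change (Rabs (t + eps / 2 - t) < eps).
      rewrite Rabs_pos_eq; lra. }
  destruct Ht as (t & Hne & [eps Heps]).
  set (d := Rmin eps (Rabs (phi t - t))).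
  assert (Hd : 0 < d).
  { apply Rmin_pos; [apply cond_pos | apply Rabs_pos_lt; lra]. }
  assert (Hd1 : d <= eps) by apply Rmin_l.
  assert (Hd2 : d <= Rabs (phi t - t)) by apply Rmin_r.
  set (p := t - d); set (q := t + d); set (u := bump p q).
  assert (Hfix : forall s, p < s < q -> phi (phi s) = s).
  { intros s Hs; apply Heps; change (Rabs (s - t) < eps).
    unfold p, q in Hs; apply Rabs_def1; lra. }
  assert (Hinj : forall a b, phi a = phi b -> a = b).
  { intros a b E; destruct (Rtotal_order a b) as [H|[H|H]]; [|exact H|];
      apply hphi in H; lra. }
  assert (Hu : forall s, u (phi (phi s)) = u s).
  { intros s; destruct (classic (p < s < q)) as [Hs|Hs]; [now rewrite Hfix|].
    unfold u; rewrite (bump_out p q s), bump_out; [reflexivity| |];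
      apply NNPP; intros Ho; apply Hs; [|lra].
    assert (E : phi (phi s) = s) by (apply Hinj, Hinj, Hfix; lra).
    rewrite E in Ho; lra. }
  destruct (schwartz_of_compact_support u p q) as [U HU];
    [unfold p, q; lra | apply bump_smooth | intros x Hx; apply bump_out, Hx|].
  destruct (schwartz_comb U (comp_op phi U) c) as [g Hg].
  assert (Hgr : forall x, g x = RtoC (u x + c * u (phi x))).
  { intros x; rewrite Hg, comp_opE, !HU, RtoC_plus, RtoC_mult; reflexivity. }
  exists g; split.
  - exists t; rewrite Hgr.
    assert (H1 : 0 < u t) by (apply bump_in; unfold p, q; lra).
    assert (H2 : u (phi t) = 0).
    { apply bump_out; unfold p, q; revert Hd2; unfold Rabs.
      destruct Rcase_abs; lra. }
    rewrite H2; intros H; apply RtoC_inj in H; lra.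
  - intros x; rewrite comp_opE, !Hgr, <- RtoC_mult, Hu; f_equal.
    rewrite Rmult_plus_distr_l, <- Rmult_assoc, Hc; ring.
Qed.

Theorem proposition7 (phi : symbol) (hphi : strict_decreasing phi) :
  ((exists lambda : C, point_spectrum (comp_op phi) lambda) <->
   (exists t : R, locally t (fun s : R => phi (phi s) = s))) /\
  ((exists t : R, locally t (fun s : R => phi (phi s) = s)) <->
   (forall lambda : C, point_spectrum (comp_op phi) lambda <->
      (lambda = RtoC (-1) \/ lambda = RtoC 1))).
Proof.
  assert (Hba : (exists t : R, locally t (fun s : R => phi (phi s) = s)) ->
    forall c : R, c * c = 1 -> point_spectrum (comp_op phi) (RtoC c))
    by (intros Ht c Hc; now apply pm1_eigenvalue).
  assert (Hab : (exists lambda : C, point_spectrum (comp_op phi) lambda) ->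
    exists t : R, locally t (fun s : R => phi (phi s) = s)).
  { intros (lambda & f & Hne & Hf).
    apply (square_fixpoints_interior phi f lambda); [exact hphi | | exact Hne].
    intros x; rewrite <- comp_opE; apply Hf. }
  split; split.
  - exact Hab.
  - intros Ht; exists (RtoC 1); apply Hba; [exact Ht | ring].
  - intros Ht lambda; split.
    + intros (f & Hne & Hf).
      apply (eigenvalue_pm1 phi f lambda); [exact hphi | | exact Hne].
      intros x; rewrite <- comp_opE; apply Hf.
    + intros [->| ->]; apply Hba; try exact Ht; ring.
  - intros Hspec; apply Hab; exists (RtoC 1); apply Hspec; now right.
Qed.
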